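(* Let $d\geq 1$ and let $\gamma=(\gamma_1,\ldots,\gamma_d)\in\mathbb{R}_{>0}^d$. For $n\in\mathbb{N}$ let $\Delta_n:=\{m\in\mathbb{N}^d \mid m\cdot\gamma<n+1\}$. Then \[\lim_{n\to\infty}\frac{\operatorname{mean}(\Delta_n\cdot\gamma)}{\max(\Delta_n\cdot\gamma)}=\frac{d}{d+1}.\]
   Context: $\mathbb{N}=\{0,1,2,\ldots\}$. For $x=(x_1,\ldots,x_d)\in\mathbb{R}^d$, $x\cdot\gamma:=x_1\gamma_1+\cdots+x_d\gamma_d$ is the weight of $x$ with regard to the weight vector $\gamma$. For a finite nonempty subset $B\subseteq\mathbb{N}^d$, $B\cdot\gamma:=\{b\cdot\gamma\mid b\in B\}$, $\max(B\cdot\gamma)$ is the largest weight of an element of $B$, and $\operatorname{mean}(B\cdot\gamma):=\frac{1}{\#B}\sum_{b\in B}b\cdot\gamma$ is the mean weight of the elements of $B$ (the average is over the elements $b\in B$, so weights are counted with multiplicity). The quotient is defined for all sufficiently large $n$, since then $\max(\Delta_n\cdot\gamma)>0$. *)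

(* Defs.v *)
From HB Require Import structures.
From mathcomp Require Import all_boot all_order all_algebra.
From mathcomp Require Import finmap.
From mathcomp Require Import all_classical all_reals all_analysis.

Set Implicit Arguments.
Unset Strict Implicit.
Unset Printing Implicit Defensive.

Import Order.TTheory GRing.Theory Num.Theory.
Import numFieldNormedType.Exports.

Local Open Scope classical_set_scope.
Local Open Scope ring_scope.

(* Points of N^d and weight vectors are row vectors. *)
Definition weight (R : realType) (d : nat) (gamma : 'rV[R]_d)
    (m : 'rV[nat]_d) : R :=
  \sum_(i < d) (m ord0 i)%:R * gamma ord0 i.

(* The supremum is attained when B is nonempty: see [max_weight_mem]. *)
Definition max_weight (R : realType) (d : nat) (gamma : 'rV[R]_d)
    (B : {fset 'rV[nat]_d}) : R :=
  sup [set weight gamma b | b in [set` B]].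

Definition mean_weight (R : realType) (d : nat) (gamma : 'rV[R]_d)
    (B : {fset 'rV[nat]_d}) : R :=
  (\sum_(b <- B) weight gamma b) / #|` B|%:R.

(* [fset_set] returns the empty set on infinite sets; [mem_Delta] shows that
   this does not happen for positive gamma. *)
Definition Delta (R : realType) (d : nat) (gamma : 'rV[R]_d) (n : nat) :
    {fset 'rV[nat]_d} :=
  fset_set [set m : 'rV[nat]_d | weight gamma m < n.+1%:R].

Lemma finite_Delta (R : realType) (d : nat) (gamma : 'rV[R]_d) (n : nat) :
  (forall i, 0 < gamma ord0 i) ->
  finite_set [set m : 'rV[nat]_d | weight gamma m < n.+1%:R].
Proof.
move=> g_gt0.
pose K := (\max_(i < d) Num.truncn (n.+1%:R / gamma ord0 i))%N.
pose f (u : {ffun 'I_d -> 'I_K.+1}) : 'rV[nat]_d := \row_i (u i : nat).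
apply: (@sub_finite_set _ _ [set f u | u in setT]); last first.
  exact/finite_image/finite_finset.
move=> m /= mn; exists [ffun i => inord (m ord0 i)] => //.
apply/rowP => i; rewrite mxE ffunE inordK// ltnS.
apply: leq_trans (leq_bigmax i).
rewrite truncn_ge_nat ?divr_ge0 ?ler0n ?(ltW (g_gt0 i))//.
rewrite ler_pdivlMr// (le_trans _ (ltW mn))// /weight (bigD1 i)//= lerDl.
by apply: sumr_ge0 => j _; rewrite mulr_ge0 ?ler0n ?(ltW (g_gt0 j)).
Qed.

Lemma mem_Delta (R : realType) (d : nat) (gamma : 'rV[R]_d) (n : nat)
    (m : 'rV[nat]_d) : (forall i, 0 < gamma ord0 i) ->
  (m \in Delta gamma n) = (weight gamma m < n.+1%:R).
Proof.
move=> g_gt0; rewrite in_fset_set; last exact: finite_Delta.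
by apply/idP/idP; rewrite inE.
Qed.

Lemma max_weight_mem (R : realType) (d : nat) (gamma : 'rV[R]_d)
    (B : {fset 'rV[nat]_d}) : B != fset0 ->
  exists2 b, b \in B & max_weight gamma B = weight gamma b.
Proof.
case/fset0Pn => b0 b0B.
pose b := [arg max_(b > [` b0B]%fset in predT) weight gamma (val b)]%O.
have bmax c : c \in B -> weight gamma c <= weight gamma (val b).
  by move=> cB; rewrite /b; case: arg_maxP => // i _ /(_ [` cB]%fset isT).
exists (val b); first exact: valP.
apply/le_anti/andP; split.
  apply: ge_sup; first by exists (weight gamma b0); exists b0.
  by move=> _ [c cB <-]; exact: bmax.
apply: ub_le_sup; last by exists (val b) => //; exact: (valP b).
by exists (weight gamma (val b)) => _ [c cB <-]; exact: bmax.
Qed.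

Lemma weight_le_max (R : realType) (d : nat) (gamma : 'rV[R]_d)
    (B : {fset 'rV[nat]_d}) (b : 'rV[nat]_d) :
  b \in B -> weight gamma b <= max_weight gamma B.
Proof.
move=> bB; apply: ub_le_sup; last by exists b.
exists (\big[Num.max/0]_(c <- B) weight gamma c) => _ [c cB <-].
exact: le_bigmax_seq.
Qed.

(* Main.v *)
Require Import Defs.
From HB Require Import structures.
From mathcomp Require Import all_boot all_order all_algebra.
From mathcomp Require Import finmap.
From mathcomp Require Import all_classical all_reals all_analysis.
From mathcomp Require Import ring lra.
Import Order.TTheory GRing.Theory Num.Theory.
Import numFieldNormedType.Exports.

Local Open Scope classical_set_scope.
Local Open Scope ring_scope.

(** Write x for n + 1, N for the number of points of Delta_n, s for the sum of
    the gamma_i and P for their product.  The points of Delta_n are the lattice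
    points of the simplex m . gamma < x, so N should be close to its volume
    x^d / (d! P), and the sum of the deficits x - m . gamma should be close to
    the volume x^(d+1) / ((d+1)! P) of the pyramid of height x over it.  The
    mean deficit is therefore about x / (d+1), the mean weight about
    x d / (d+1), while the largest weight is x up to a bounded error.

    Both volume estimates are the cases p = 0 and p = 1 of the explicit bounds
      p! x^(d+p) <= (d+p)! P A_p(x) <= p! (x + s)^(d+p)
    for A_p(x), the sum of (x - m . gamma)^p over the lattice points m with
    m . gamma < x ([power_sum_bounds]).  They are proved by induction on d:
    slicing along the first coordinate k writes A_p(x) as a sum over k of the
    (d-1)-dimensional A_p(x - k gamma_1), which is compared to the integral of
    y^(d-1+p) by telescoping ([riemann_sum_ge], [riemann_sum_le]).

    Dividing the two cases shows that 1 - mean / x lies between r^(-d) / (d+1)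
    and r^(d+1) / (d+1), where r = 1 + s / x tends to 1 ([deficit_bounds]).
    For the maximum, a point of largest weight leaves the simplex when one of
    its coordinates is increased, so that x - gamma_i <= max <= x
    ([max_weight_bounds]). *)

(** * Comparing power sums with integrals *)

(** Bounds on the integral of (q+1) y^q over [b, a], in a form that needs no
    integration. *)
Lemma exprB_bounds (R : realFieldType) (q : nat) (a b : R) : 0 <= b <= a ->
  q.+1%:R * b ^+ q * (a - b) <= a ^+ q.+1 - b ^+ q.+1
    <= q.+1%:R * a ^+ q * (a - b).
Proof.
move=> /andP[b0 ba]; have a0 := le_trans b0 ba.
have ab0 : 0 <= a - b by rewrite subr_ge0.
have E (c : R) : \sum_(i < q.+1) c ^+ (q - i) * c ^+ i = q.+1%:R * c ^+ q.
  rewrite (eq_bigr (fun=> c ^+ q)) ?sumr_const ?card_ord ?mulr_natl// => i _.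
  by rewrite -exprD subnK// -ltnS.
rewrite subrXX /= mulrC [X in _ && (_ <= X)]mulrC.
apply/andP; split; apply: ler_wpM2l => //; rewrite -E; apply: ler_sum => i _.
  by rewrite ler_wpM2r ?exprn_ge0 ?lerXn2r ?nnegrE.
by rewrite ler_wpM2l ?exprn_ge0 ?lerXn2r ?nnegrE.
Qed.

(** The integral of (q+1) C y^q from 0 to x is C x^(q+1).  Cut [0, x] from the
    right into pieces of length g, the last one possibly shorter; y^q is at
    most its value at the right end of each piece. *)
Lemma riemann_sum_ge (R : realFieldType) (f : R -> R) (q K : nat) (C g x : R) :
  0 <= C -> 0 < g -> x <= K%:R * g -> 0 < x ->
  (forall y, 0 <= f y) -> (forall y, 0 < y <= x -> C * y ^+ q <= f y) ->
  C * x ^+ q.+1 <= q.+1%:R * g * \sum_(0 <= k < K) f (x - k%:R * g).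
Proof.
move=> C0 g0 xK x0 f0 fC.
(* the contribution to the integral of what lies to the left of x - k g *)
pose u k := C * Num.max (x - k%:R * g) 0 ^+ q.+1.
have -> : C * x ^+ q.+1 = - (u K - u 0%N).
  rewrite /u mul0r subr0 (max_l (ltW x0)) max_r ?subr_le0//.
  by rewrite expr0n/= mulr0 sub0r opprK.
rewrite -telescope_sumr// -sumrN mulr_sumr; apply: ler_sum => k _.
rewrite opprB /u -mulrBr.
have [yle0|ygt0] := leP (x - k%:R * g) 0.
  rewrite max_r; last by rewrite -natr1 mulrDl; lra.
  by rewrite subrr mulr0 !mulr_ge0 ?f0// ltW.
set y := x - k%:R * g in ygt0 *.
have -> : x - k.+1%:R * g = y - g by rewrite /y -natr1; ring.
set b := Num.max (y - g) 0.
have b0 : 0 <= b by rewrite /b le_max lexx orbT.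
have by_ : b <= y by rewrite /b ge_max; apply/andP; split; lra.
have yb : y - b <= g.
  have : y - g <= b by rewrite /b le_max lexx.
  lra.
have /andP[_ le1] := @exprB_bounds _ q y b (introT andP (conj b0 by_)).
have yx : 0 < y <= x by rewrite ygt0 lerBlDr lerDl mulr_ge0// ltW.
apply: (le_trans (ler_wpM2l C0 le1)).
have -> : C * (q.+1%:R * y ^+ q * (y - b)) = q.+1%:R * (y - b) * (C * y ^+ q).
  by ring.
apply: ler_pM; rewrite ?mulr_ge0 ?subr_ge0 ?exprn_ge0 ?(ltW ygt0)//.
  by rewrite ler_wpM2l.
exact: fC.
Qed.

(** The same comparison from above: the value (y + s)^q of the integrand at the
    left end of the piece [y + s, y + s + g] bounds it from below there, and
    these disjoint pieces lie in [0, x + s + g]. *)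
Lemma riemann_sum_le (R : realFieldType) (f : R -> R) (q K : nat)
    (C g s x : R) :
  0 <= C -> 0 < g -> 0 <= s -> 0 < x ->
  (forall y, y <= 0 -> f y = 0) ->
  (forall y, 0 < y <= x -> f y <= C * (y + s) ^+ q) ->
  q.+1%:R * g * \sum_(0 <= k < K) f (x - k%:R * g) <=
    C * (x + (g + s)) ^+ q.+1.
Proof.
move=> C0 g0 s0 x0 f0 fC.
pose v k := C * Num.max (x + (g + s) - k%:R * g) 0 ^+ q.+1.
apply: (@le_trans _ _ (- (v K - v 0%N))); last first.
  rewrite opprB {1}/v mul0r subr0 max_l; last by lra.
  by rewrite lerBlDr lerDl mulr_ge0// exprn_ge0// le_max lexx orbT.
rewrite -telescope_sumr// -sumrN mulr_sumr; apply: ler_sum => k _.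
rewrite opprB /v -mulrBr.
set y := x - k%:R * g.
have -> : x + (g + s) - k.+1%:R * g = y + s by rewrite /y -natr1; ring.
have -> : x + (g + s) - k%:R * g = y + s + g by rewrite /y; ring.
have [yle0|ygt0] := leP y 0.
  have max0 (z : R) : 0 <= Num.max z 0 by rewrite le_max lexx orbT.
  rewrite f0// mulr0 mulr_ge0// subr_ge0 lerXn2r ?nnegrE ?max0//.
  by apply: le_max2 => //; lra.
rewrite !max_l; [|lra|lra].
have ab : 0 <= y + s <= y + s + g by lra.
have /andP[le1 _] := @exprB_bounds _ q _ _ ab.
have yx : 0 < y <= x by rewrite ygt0 lerBlDr lerDl mulr_ge0// ltW.
apply: le_trans (ler_wpM2l C0 le1).
have -> : C * (q.+1%:R * (y + s) ^+ q * (y + s + g - (y + s))) =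
  q.+1%:R * g * (C * (y + s) ^+ q) by ring.
by rewrite ler_wpM2l ?fC// mulr_ge0// ltW.
Qed.

(** * Enumerating lattice points coordinate by coordinate *)

Definition row_cons {d : nat} (k : nat) (v : 'rV[nat]_d) : 'rV[nat]_d.+1 :=
  \row_i oapp (v ord0) k (unlift ord0 i).

(** The points of N^d with all coordinates below K, listed so that sums over
    them split along the first coordinate. *)
Fixpoint box (K d : nat) : seq 'rV[nat]_d :=
  if d is d'.+1 then [seq row_cons k v | k <- index_iota 0 K, v <- box K d']
  else [:: \row_i 0%N].

Lemma row_cons0 d k (v : 'rV[nat]_d) : row_cons k v ord0 ord0 = k.
Proof. by rewrite mxE unlift_none. Qed.

Lemma row_consS d k (v : 'rV[nat]_d) i :
  row_cons k v ord0 (lift ord0 i) = v ord0 i.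
Proof. by rewrite mxE liftK. Qed.

Lemma box_uniq K d : uniq (box K d).
Proof.
elim: d => //= d IH; apply: allpairs_uniq; rewrite ?iota_uniq//.
move=> [k v] [l w] _ _ /= E; congr pair.
  by rewrite -(row_cons0 d k v) E row_cons0.
by apply/rowP => i; rewrite -(row_consS d k v) E row_consS.
Qed.

Lemma mem_box K d (m : 'rV[nat]_d) :
  (m \in box K d) = [forall i, (m ord0 i < K)%N].
Proof.
elim: d m => [|d IH] m.
  rewrite inE; transitivity true; first by apply/eqP/rowP; case.
  by apply/esym/forallP; case.
apply/allpairsP/forallP => [[[k v]/= [kK vK ->]] i|mK].
  rewrite mem_index_iota/= in kK; rewrite IH in vK.
  case: (unliftP ord0 i) => [j|] ->; first by rewrite row_consS (forallP vK).
  by rewrite row_cons0.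
exists (m ord0 ord0, col' ord0 m) => /=; split.
- by rewrite mem_index_iota mK.
- by rewrite IH; apply/forallP => i; rewrite mxE mK.
apply/rowP => i; case: (unliftP ord0 i) => [j|] ->.
  by rewrite row_consS mxE.
by rewrite row_cons0.
Qed.

Lemma weight_row_cons (R : realType) d (gamma : 'rV[R]_d.+1) k v :
  weight gamma (row_cons k v) =
  k%:R * gamma ord0 ord0 + weight (col' ord0 gamma) v.
Proof.
rewrite /weight big_ord_recl row_cons0; congr (_ + _).
by apply: eq_bigr => i _; rewrite row_consS mxE.
Qed.

(** * Lattice points of a simplex *)

(** The positive part of y to the power p; for p = 0 it is the indicator of
    y > 0, which makes sums of it count the points of an open condition. *)
Definition trunc_pow {R : realFieldType} (p : nat) (y : R) : R :=
  if 0 < y then y ^+ p else 0.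

(** When the box contains the simplex, this is A_p(x); taking truncated powers
    over a fixed box instead of powers over the simplex keeps the index set
    independent of x, as slicing requires. *)
Definition power_sum {R : realType} (K : nat) {d : nat} (p : nat)
    (gamma : 'rV[R]_d) (x : R) :=
  \sum_(m <- box K d) trunc_pow p (x - weight gamma m).

Lemma power_sumS (R : realType) K d p (gamma : 'rV[R]_d.+1) (x : R) :
  power_sum K p gamma x =
  \sum_(0 <= k < K)
    power_sum K p (col' ord0 gamma) (x - k%:R * gamma ord0 ord0).
Proof.
rewrite /power_sum /= big_allpairs_dep/=; apply: eq_bigr => k _.
by apply: eq_bigr => v _; rewrite weight_row_cons opprD addrA.
Qed.

Lemma trunc_pow_ge0 (R : realFieldType) p (y : R) : 0 <= trunc_pow p y.
Proof. by rewrite /trunc_pow; case: ifP => // /ltW; exact: exprn_ge0. Qed.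

Lemma weight_ge0 (R : realType) d (gamma : 'rV[R]_d) m :
  (forall i, 0 < gamma ord0 i) -> 0 <= weight gamma m.
Proof. by move=> g0; apply: sumr_ge0 => i _; rewrite mulr_ge0// ltW. Qed.

Lemma power_sum_ge0 (R : realType) K d p (gamma : 'rV[R]_d) (x : R) :
  0 <= power_sum K p gamma x.
Proof. by apply: sumr_ge0 => m _; exact: trunc_pow_ge0. Qed.

Lemma power_sum_eq0 (R : realType) K d p (gamma : 'rV[R]_d) (x : R) :
  (forall i, 0 < gamma ord0 i) -> x <= 0 -> power_sum K p gamma x = 0.
Proof.
move=> g0 x0; apply: big1 => m _; rewrite /trunc_pow ifF//.
apply/negbTE; rewrite -leNgt subr_le0 (le_trans x0)//; exact: weight_ge0.
Qed.

(** Each coordinate integrates the power once and divides by gamma_i.  The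
    shift by s above is the sum of the mesh sizes gamma_i: the cells spanned by
    the counted points stay inside the simplex enlarged by s.  The lower bound
    needs a box that contains the simplex; that box then serves for all its
    slices as well. *)
Lemma power_sum_bounds (R : realType) K d p (gamma : 'rV[R]_d) (x : R) :
  (forall i, 0 < gamma ord0 i) -> (forall i, x <= K%:R * gamma ord0 i) ->
  0 < x ->
  p`!%:R * x ^+ (d + p) <=
    (d + p)`!%:R * (\prod_i gamma ord0 i) * power_sum K p gamma x <=
  p`!%:R * (x + \sum_i gamma ord0 i) ^+ (d + p).
Proof.
elim: d gamma x => [|d IH] gamma x g0 xK x0.
  rewrite /power_sum /= big_seq1 /weight !big_ord0 mulr1 subr0 addr0.
  by rewrite /trunc_pow x0 lexx.
pose h := gamma ord0 ord0; pose gamma' := col' ord0 gamma.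
have h0 : 0 < h := g0 _.
have g'0 i : 0 < gamma' ord0 i by rewrite mxE.
have Pi0 : 0 < \prod_i gamma' ord0 i by apply: prodr_gt0 => i _.
(* the power sum of a slice of size y, scaled so that the induction hypothesis
   has no denominators *)
pose f y := (d + p)`!%:R * (\prod_i gamma' ord0 i) * power_sum K p gamma' y.
have IHf y : 0 < y <= x ->
    p`!%:R * y ^+ (d + p) <= f y <=
    p`!%:R * (y + \sum_i gamma' ord0 i) ^+ (d + p).
  move=> /andP[y0 yx]; apply: IH => // i.
  by rewrite mxE (le_trans yx).
have -> : \sum_i gamma ord0 i = h + \sum_i gamma' ord0 i.
  by rewrite big_ord_recl; congr (_ + _); apply: eq_bigr => i _; rewrite mxE.
have -> : (d.+1 + p)`!%:R * (\prod_i gamma ord0 i) *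
      power_sum K p gamma x =
    (d + p).+1%:R * h * \sum_(0 <= k < K) f (x - k%:R * h).
  rewrite -mulr_sumr -power_sumS big_ord_recl addSn factS natrM.
  have -> : \prod_(i < d) gamma ord0 (lift ord0 i) = \prod_i gamma' ord0 i.
    by apply: eq_bigr => i _; rewrite mxE.
  by rewrite -/h; ring.
rewrite addSn; apply/andP; split.
- apply: riemann_sum_ge => //; first exact: xK.
    by move=> y; rewrite !mulr_ge0 ?power_sum_ge0 ?ltW.
  by move=> y /IHf/andP[].
- apply: riemann_sum_le => //.
  + by apply: sumr_ge0 => i _; exact: ltW.
  + by move=> y y0; rewrite /f power_sum_eq0 ?mulr0.
  + by move=> y /IHf/andP[].
Qed.

Lemma le_weight (R : realType) d (gamma : 'rV[R]_d) (m : 'rV[nat]_d) i :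
  (forall j, 0 < gamma ord0 j) ->
  (m ord0 i)%:R * gamma ord0 i <= weight gamma m.
Proof.
move=> g0; rewrite /weight (bigD1 i)//= lerDl.
by apply: sumr_ge0 => j _; rewrite mulr_ge0// ltW.
Qed.

(** * Mean and maximum of the weights *)

(** A single box enumerates the whole simplex for all exponents p, so that the
    count (p = 0) and the total deficit (p = 1) can be compared. *)
Lemma power_sum_Delta (R : realType) d (gamma : 'rV[R]_d) (n : nat) :
  (forall i, 0 < gamma ord0 i) ->
  exists2 K : nat, (forall i, n.+1%:R <= K%:R * gamma ord0 i) &
    forall p, power_sum K p gamma n.+1%:R =
      \sum_(m <- Delta gamma n) (n.+1%:R - weight gamma m) ^+ p.
Proof.
move=> g0; pose K := (\max_(i < d) Num.truncn (n.+1%:R / gamma ord0 i)).+1.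
have xK i : n.+1%:R <= K%:R * gamma ord0 i.
  rewrite -ler_pdivrMr//; apply/ltW/(lt_le_trans (truncnS_gt _)).
  by rewrite ler_nat ltnS leq_bigmax.
exists K => // p.
rewrite /power_sum /trunc_pow -big_mkcond -big_filter/=.
apply: perm_big; apply: uniq_perm; rewrite ?filter_uniq ?box_uniq ?fset_uniq//.
move=> m; rewrite mem_filter subr_gt0 mem_box mem_Delta//.
apply: andb_idr => mn; apply/forallP => i.
rewrite -(ltr_nat R) -(ltr_pM2r (g0 i)).
exact: le_lt_trans (le_weight _ _ _ _ _ g0) (lt_le_trans mn (xK i)).
Qed.

Lemma mem_Delta0 (R : realType) d (gamma : 'rV[R]_d) (n : nat) :
  (forall i, 0 < gamma ord0 i) -> \row_i 0%N \in Delta gamma n.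
Proof.
move=> g0; rewrite mem_Delta// /weight big1 ?ltr0n// => i _.
by rewrite mxE mul0r.
Qed.

Lemma Delta_card_gt0 (R : realType) d (gamma : 'rV[R]_d) (n : nat) :
  (forall i, 0 < gamma ord0 i) -> 0 < #|` Delta gamma n|%:R :> R.
Proof.
move=> g0; rewrite ltr0n cardfs_gt0; apply/fset0Pn.
by exists (\row_i 0%N); exact: mem_Delta0.
Qed.

(** The quantity bounded is the mean of the deficits x - m . gamma, relative
    to x: the quotient of A_1(x) by x A_0(x).  Each of the two factors is
    known up to a power of r = (x + s) / x. *)
Lemma deficit_bounds (R : realType) d (gamma : 'rV[R]_d) (n : nat) :
  (forall i, 0 < gamma ord0 i) ->
  d.+1%:R^-1 * ((1 + (\sum_i gamma ord0 i) / n.+1%:R) ^+ d)^-1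
    <= 1 - mean_weight gamma (Delta gamma n) / n.+1%:R
    <= d.+1%:R^-1 * (1 + (\sum_i gamma ord0 i) / n.+1%:R) ^+ d.+1.
Proof.
move=> g0; pose x : R := n.+1%:R; rewrite -/x.
set r := 1 + _ / x.
have [K xK KE] := power_sum_Delta R d gamma n g0.
have x0 : 0 < x by rewrite ltr0n.
have N0 := Delta_card_gt0 R d gamma n g0.
rewrite /mean_weight.
set N := #|` Delta gamma n|%:R in N0 *.
set S := \sum_(b <- Delta gamma n) weight gamma b.
have constE (c : R) : \sum_(m <- Delta gamma n) c = c * N.
  rewrite /N card_fset_sum1 natr_sum mulr_sumr.
  by apply: eq_bigr => m _; rewrite mulr1.
have := power_sum_bounds R K d 1 gamma x g0 xK x0.
rewrite KE sumrB constE -/x -/S addn1.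
have := power_sum_bounds R K d 0 gamma x g0 xK x0.
rewrite KE constE mul1r addn0 fact0 (erefl : 1`! = 1)%N !mul1r.
set P := \prod_i _.
have -> : x + \sum_i gamma ord0 i = x * r by rewrite /r; field; rewrite gt_eqF.
have r0 : 0 < r.
  rewrite ltr_wpDr// divr_ge0 ?(ltW x0)//.
  by apply: sumr_ge0 => i _; exact: ltW.
have P0 : 0 < P by apply: prodr_gt0.
have df0 : 0 < d`!%:R :> R by rewrite ltr0n fact_gt0.
have c0 : 0 < d`!%:R * P by rewrite mulr_gt0.
rewrite factS natrM => /andP[N1 N2] /andP[S1 S2].
have d0 : 0 < d.+1%:R :> R by rewrite ltr0n.
(* isolates the quantities bounded by N1, N2 and S1, S2 *)
have -> : 1 - S / N / x =
    d.+1%:R^-1 *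
      ((d.+1%:R * d`!%:R * P * (x * N - S)) / (x * (d`!%:R * P * N))).
  by field; rewrite !gt_eqF.
rewrite !ler_pM2l ?invr_gt0//.
have xa0 : 0 < x * (d`!%:R * P * N) by rewrite !mulr_gt0.
rewrite ler_pdivrMr// ler_pdivlMr// ler_pdivrMl ?exprn_gt0//.
apply/andP; split.
- apply: (@le_trans _ _ (x * (x * r) ^+ d)); first by rewrite ler_pM2l.
  by rewrite exprMn mulrA -exprS mulrC ler_pM2l ?exprn_gt0.
- apply: (le_trans S2).
  by rewrite exprMn mulrC ler_pM2l ?exprn_gt0// exprS ler_pM2l.
Qed.

(** Increasing coordinate i of a point of largest weight leaves Delta_n. *)
Lemma max_weight_bounds (R : realType) d (gamma : 'rV[R]_d) (n : nat)
    (i : 'I_d) :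
  (forall i, 0 < gamma ord0 i) ->
  n.+1%:R - gamma ord0 i <= max_weight gamma (Delta gamma n) <= n.+1%:R.
Proof.
move=> g0.
have D0 : Delta gamma n != fset0.
  by apply/fset0Pn; exists (\row_i 0%N); exact: mem_Delta0.
have [b bD E] := max_weight_mem gamma D0.
apply/andP; split; last first.
  by rewrite E ltW// -mem_Delta.
rewrite leNgt; apply/negP => lt.
pose c : 'rV[nat]_d := \row_j (b ord0 j + (j == i))%N.
have cE : weight gamma c = weight gamma b + gamma ord0 i.
  rewrite /weight; under eq_bigr do rewrite mxE natrD mulrDl.
  rewrite big_split/=; congr (_ + _).
  rewrite (bigD1 i)//= eqxx mul1r big1 ?addr0// => j /negbTE ->.
  by rewrite mul0r.
have : c \in Delta gamma n by rewrite mem_Delta// cE -E; lra.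
by move/(weight_le_max gamma); rewrite cE -E; have := g0 i; lra.
Qed.

Lemma cvg_divS (R : realType) (c : R) : (c / n.+1%:R) @[n --> \oo] --> 0.
Proof.
rewrite -[X in _ --> X](mulr0 c).
by apply: cvgM; [exact: cvg_cst|exact: cvg_harmonic].
Qed.

Lemma cvg_mean_weight (R : realType) d (gamma : 'rV[R]_d) :
  (forall i, 0 < gamma ord0 i) ->
  (mean_weight gamma (Delta gamma n) / n.+1%:R) @[n --> \oo]
    --> (d%:R / d.+1%:R : R).
Proof.
move=> g0.
pose r n : R := 1 + (\sum_i gamma ord0 i) / n.+1%:R.
have r1 : r n @[n --> \oo] --> (1 : R).
  rewrite -[X in _ --> X](addr0 1).
  by apply: cvgD; [exact: cvg_cst|exact: cvg_divS].
have rX p : (r n ^+ p) @[n --> \oo] --> (1 : R).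
  have := cvg_comp _ _ r1 (@exprn_continuous R p 1); rewrite expr1n; exact.
have lim : (1 - mean_weight gamma (Delta gamma n) / n.+1%:R) @[n --> \oo]
    --> (d.+1%:R^-1 : R).
  apply: (@squeeze_cvgr _ _ _ _ (fun n => d.+1%:R^-1 * (r n ^+ d)^-1)
    (fun n => d.+1%:R^-1 * r n ^+ d.+1)).
  - by near=> n; exact: deficit_bounds.
  - rewrite -[X in _ --> X]mulr1 -[X in _ * X]invr1.
    by apply: cvgM; [exact: cvg_cst|apply: cvgV; [exact: oner_neq0|exact: rX]].
  - by rewrite -[X in _ --> X]mulr1; apply: cvgM; [exact: cvg_cst|exact: rX].
have -> : d%:R / d.+1%:R = 1 - d.+1%:R^-1 :> R.
  by rewrite -natr1; field; rewrite natr1 pnatr_eq0.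
rewrite (_ : (fun n => _) = (fun n : nat =>
  1 - (1 - mean_weight gamma (Delta gamma n) / n.+1%:R))); last first.
  by apply/funext => n; rewrite subKr.
by apply: cvgB => //; exact: cvg_cst.
Unshelve. all: by end_near. Qed.

Lemma cvg_max_weight (R : realType) d (gamma : 'rV[R]_d) (i : 'I_d) :
  (forall i, 0 < gamma ord0 i) ->
  (max_weight gamma (Delta gamma n) / n.+1%:R) @[n --> \oo] --> (1 : R).
Proof.
move=> g0.
apply: (@squeeze_cvgr _ _ _ _ (fun n => 1 - gamma ord0 i / n.+1%:R)
    (fun n => 1)).
- near=> n.
  have x0 : 0 < n.+1%:R :> R by rewrite ltr0n.
  have /andP[m1 m2] := max_weight_bounds R d gamma n i g0.
  rewrite ler_pdivlMr// ler_pdivrMr// mulrBl mulfVK ?gt_eqF// !mul1r.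
  exact/andP.
- rewrite -[X in _ --> X](subr0 1).
  by apply: cvgB; [exact: cvg_cst|exact: cvg_divS].
- exact: cvg_cst.
Unshelve. all: by end_near. Qed.

Theorem corollary1p4 (R : realType) (d : nat) (gamma : 'rV[R]_d) :
  (1 <= d)%N ->
  (forall i : 'I_d, 0 < gamma ord0 i) ->
  (fun n : nat => mean_weight gamma (Delta gamma n) /
                  max_weight gamma (Delta gamma n)) @ \oo
    --> (d%:R / d.+1%:R : R).
Proof.
move=> d1 g0.
have mean := cvg_mean_weight R d gamma g0.
have max := cvg_max_weight R d gamma (Ordinal d1) g0.
have -> : d%:R / d.+1%:R = d%:R / d.+1%:R * 1^-1 :> R by rewrite invr1 mulr1.
rewrite (_ : (fun n => _) = (fun n : nat =>
  mean_weight gamma (Delta gamma n) / n.+1%:R *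
  (max_weight gamma (Delta gamma n) / n.+1%:R)^-1)); last first.
  by apply/funext => n; rewrite invf_div mulrA divfK ?pnatr_eq0.
by apply: cvgM => //; apply: cvgV => //; exact: oner_neq0.
Qed.
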